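(* Let $\{(X(t),Y(t))\}_{t\ge0}$ be a standard orthogonal planar random motion with speed $c>0$ and rate function $\lambda(t)\in C^2\bigl((0,\infty),[0,\infty)\bigr)$. Then $\{(X(t),Y(t))\}_{t\ge0}$ is equal in distribution to the following linear transformation of two independent one-dimensional telegraph processes $\{U(t)\}_{t\ge0}$, $\{V(t)\}_{t\ge0}$, each with parameters $(c/2,\lambda(t)/2)$: $$\begin{cases}X(t)=U(t)+V(t),\\ Y(t)=U(t)-V(t).\end{cases}$$
   Context: Directions: $d_k=(\cos(k\pi/2),\sin(k\pi/2))$, $k=0,1,2,3$, with indices taken modulo 4. Let $\{N(t)\}_{t\ge0}$ be a non-homogeneous Poisson process with rate function $\lambda(t)$. The standard orthogonal planar random motion with speed $c$ and rate function $\lambda$ is the position $(X(t),Y(t))$ of a particle that starts at the origin at time $0$ with initial direction uniformly distributed on $\{d_0,d_1,d_2,d_3\}$, moves with velocity $c\,d_k$ as long as its current direction is $d_k$, and at each event of $N$ switches from its current direction $d_k$ to $d_{k+1}$ or $d_{k-1}$, each with probability $1/2$ (independently of everything else). A one-dimensional (symmetric) telegraph process with parameters $(v,\mu(t))$, i.e. velocity $v>0$ and rate function $\mu(t)$, is the position of a particle on $\mathbb{R}$ starting at $0$ with initial velocity $+v$ or $-v$, each with probability $1/2$, and reversing its velocity at each event of an independent non-homogeneous Poisson process with rate function $\mu(t)$. *)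

(* Defs.v *)
From HB Require Import structures.
From mathcomp Require Import all_boot all_order all_algebra finmap.
From mathcomp Require Import all_classical all_reals all_analysis.
Set Implicit Arguments.
Unset Strict Implicit.
Unset Printing Implicit Defensive.
Import Order.TTheory GRing.Theory Num.Theory.
Import numFieldNormedType.Exports.

Local Open Scope classical_set_scope.
Local Open Scope ring_scope.

(* f is only constrained on (0, +oo); it may be singular at 0. *)
Definition C2_nonneg (R : realType) (f : R -> R) : Prop :=
  forall t : R, 0 < t ->
    [/\ 0 <= f t, derivable f t 1, derivable (derive1 f) t 1 &
        {for t, continuous (derive1n 2 f)}].

Definition sigma_rv (d : measure_display) (T : Type) (S : measurableType d)
    (X : T -> S) : set (set T) :=
  preimage_set_system setT X measurable.

Definition sigma_process (R : realType) (d : measure_display) (T : Type)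
    (S : measurableType d) (X : R -> T -> S) : set (set T) :=
  <<s \bigcup_(t in `[0, +oo[) sigma_rv (X t) >>.

Definition mutually_independent (R : realType) (d : measure_display)
    (T : measurableType d) (P : probability T R) (I : choiceType)
    (F : I -> set (set T)) : Prop :=
  forall (J : {fset I}) (A : I -> set T),
    (forall i, i \in J -> F i (A i)) ->
    P (\bigcap_(i in [set` J]) A i) = (\prod_(i <- J) P (A i))%E.

Definition independent2 (R : realType) (d : measure_display)
    (T : measurableType d) (P : probability T R) (F G : set (set T)) : Prop :=
  forall A B, F A -> G B -> P (A `&` B) = (P A * P B)%E.

(* Equality of the laws on the path space S^[0, +oo) with its product
   sigma-algebra.  Paths are represented by functions R -> S, of which
   sigma_process only sees the coordinates t >= 0. *)
Definition eq_in_distribution (R : realType) (d d' e : measure_display)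
    (T : measurableType d) (T' : measurableType d') (S : measurableType e)
    (P : probability T R) (X : R -> T -> S)
    (P' : probability T' R) (X' : R -> T' -> S) : Prop :=
  forall A : set (R -> S), sigma_process (fun t (x : R -> S) => x t) A ->
    P [set w | A (X ^~ w)] = P' [set w | A (X' ^~ w)].

(* The Poisson weights are written out because the library's poisson_pmf is
   constantly 1 when the parameter is 0. *)
Definition poisson_process (R : realType) (d : measure_display)
    (T : measurableType d) (P : probability T R) (lambda : R -> R)
    (N : R -> T -> nat) : Prop :=
  (forall t : R, 0 <= t -> measurable_fun setT (N t)) /\
  (forall w, N 0 w = 0%N) /\
  (forall w (s t : R), 0 <= s -> s <= t -> (N s w <= N t w)%N) /\
  (forall w (t : R), 0 <= t -> \forall s \near t^'+, N s w = N t w) /\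
  (forall t : nat -> R, 0 <= t 0%N -> (forall i, t i <= t i.+1) ->
    mutually_independent P
      (fun i => sigma_rv (fun w => (N (t i.+1) w - N (t i) w)%N))) /\
  (forall t : R, 0 <= t ->
    lebesgue_measure.-integrable `]0, t] (EFin \o lambda)) /\
  (forall s t : R, 0 <= s -> s <= t -> forall k : nat,
    let L := \int[lebesgue_measure]_(x in `]s, t]) lambda x in
    P [set w | (N t w - N s w)%N = k] =
      (expR (- L) * L ^+ k / k`!%:R)%:E).

Definition direction (R : realType) (k : int) : R * R :=
  (cos (k%:~R * pi / 2), sin (k%:~R * pi / 2)).

(* Index of the direction at time t: K0 is the index of the initial direction,
   N the process of events, and turn n tells whether the index goes up or down
   by one at the (n+1)-st event.  No reduction modulo 4 is needed since
   direction is 4-periodic. *)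
Definition direction_index (R : realType) (T : Type) (K0 : T -> 'I_4)
    (turn : nat -> T -> bool) (N : R -> T -> nat) (t : R) (w : T) : int :=
  (K0 w)%:Z + \sum_(n < N t w) (if turn n w then 1 else -1).

(* The sigma-algebras generated by the events, the initial direction and the
   successive turns. *)
Definition motion_sources (R : realType) (d : measure_display)
    (T : measurableType d) (K0 : T -> 'I_4) (turn : nat -> T -> bool)
    (N : R -> T -> nat) (i : option (option nat)) : set (set T) :=
  match i with
  | None => sigma_process N
  | Some None => preimage_set_system setT K0 setT
  | Some (Some n) => sigma_rv (turn n)
  end.

Definition orthogonal_motion (R : realType) (d : measure_display)
    (T : measurableType d) (P : probability T R) (c : R) (lambda : R -> R)
    (X Y : R -> T -> R) : Prop :=
  exists (K0 : T -> 'I_4) (turn : nat -> T -> bool) (N : R -> T -> nat),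
    poisson_process P lambda N /\
    (forall k, measurable (K0 @^-1` [set k])) /\
    (forall k, P (K0 @^-1` [set k]) = (4^-1)%:E) /\
    (forall n, measurable_fun setT (turn n)) /\
    (forall n b, P (turn n @^-1` [set b]) = (2^-1)%:E) /\
    mutually_independent P (motion_sources K0 turn N) /\
    (forall (t : R) w, 0 <= t ->
      X t w = \int[lebesgue_measure]_(s in `[0, t])
        (c * (direction R (direction_index K0 turn N s w)).1) /\
      Y t w = \int[lebesgue_measure]_(s in `[0, t])
        (c * (direction R (direction_index K0 turn N s w)).2)).

(* The initial velocity is -v where D0 is true and +v elsewhere. *)
Definition telegraph_process (R : realType) (d : measure_display)
    (T : measurableType d) (P : probability T R) (v : R) (mu : R -> R)
    (U : R -> T -> R) : Prop :=
  exists (D0 : T -> bool) (N : R -> T -> nat),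
    poisson_process P mu N /\
    measurable_fun setT D0 /\
    (forall b, P (D0 @^-1` [set b]) = (2^-1)%:E) /\
    independent2 P (sigma_rv D0) (sigma_process N) /\
    (forall (t : R) w, 0 <= t ->
      U t w = \int[lebesgue_measure]_(s in `[0, t])
        (v * (-1) ^+ (D0 w + N s w))).

(* Main.v *)
Require Import Defs.
From HB Require Import structures.
From mathcomp Require Import all_boot all_order all_algebra finmap.
From mathcomp Require Import all_classical all_reals all_analysis.
From mathcomp Require Import measurable_realfun ring lra.
Import Order.TTheory GRing.Theory Num.Theory.
Import numFieldNormedType.Exports.

Local Open Scope classical_set_scope.
Local Open Scope ring_scope.

(** A particle moving in direction [d_k] with speed [c] has velocities [(c/2, c/2)],
    [(c/2, -c/2)], [(-c/2, -c/2)], [(-c/2, c/2)] for [k = 0, 1, 2, 3] in the rotated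
    coordinates [U = (X + Y)/2], [V = (X - Y)/2].  A quarter turn in either sense
    thus reverses exactly one of the two coordinates.  Which one is reversed depends
    on the current direction and on the sense of the turn, but a turn is a fair
    coin independent of the past, so each event reverses one of the two coordinates
    chosen by a fair coin.  This is a thinning of the Poisson process: the
    reversals of [U] and of [V] form independent Poisson processes of rate
    [lambda / 2].

    The thinning is carried out on finite-dimensional laws.  A direction is encoded
    by a [state], the two signs of the velocities of [U] and [V].  After [n] turns
    the law of the state is the explicit [transition] kernel, a combination of the
    functions [1], [(-1) ^ n] and [1_{n = 0}]; averaged over a Poisson variable of
    mean [L] these give [1], [exp (- 2 L)] and [exp (- L)], and the average of the
    kernel factors as a product over the two coordinates ([poisson_transition]).
    Each factor is the probability that a Poisson variable of mean [L / 2] has a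
    given parity ([poisson_increment_parity]), that is, the transition kernel of
    the sign of a telegraph process.  So the states of the planar motion
    ([motion_state_fdd]) and the pairs of signs of the two telegraph processes
    ([telegraph_sign_fdd]) have the same finite-dimensional laws.

    Passing from signs to positions and back needs two facts about the integral of
    a path with finitely many jumps.  It is the limit of its Riemann sums
    ([riemann_sum_cvg]), so positions are measurable functions of the states, and
    equality of the laws of the states passes to the positions
    ([eq_in_distribution_of_states]).  Its right derivative is the path, so the sign
    of a telegraph process is measurable for the process itself
    ([telegraph_sign_sigma_process]); independence of [U] and [V] therefore gives
    independence of their signs. *)

Set Implicit Arguments.
Unset Strict Implicit.
Unset Printing Implicit Defensive.

(** * Integrals of paths that jump finitely often *)

Section step_paths.
Context {R : realType}.
Variables (N : R -> nat) (h : nat -> R) (M : R).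
Hypothesis N_nd : forall s t : R, 0 <= s -> s <= t -> (N s <= N t)%N.
Hypothesis h_le : forall n, `|h n| <= M.

Local Notation mu := (@lebesgue_measure R).
Let I (t : R) : R := \int[mu]_(s in `[0, t]) h (N s).

(** Each level set of a monotone path is an interval. *)
Lemma measurable_step_path (t : R) :
  measurable_fun `[0, t] (fun s => h (N s)).
Proof.
move=> mD B mB; rewrite setIC.
have -> : (fun s => h (N s)) @^-1` B `&` `[0, t] =
    \bigcup_(k in [set k | B (h k)]) [set s | s \in `[0, t] /\ N s = k].
  apply/seteqP; split => s /=; first by case=> Bs ts; exists (N s).
  by move=> [k /= Bk [ts Nk]]; split => //; rewrite Nk.
apply: bigcup_measurable => k _; apply: is_interval_measurable.
move=> x y /= [/[!in_itv]/= /andP[x0 xt] Nx] [/andP[y0 yt] Ny] z /andP[xz zy].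
have z0 : 0 <= z by exact: le_trans xz.
rewrite in_itv/= z0 (le_trans zy yt); split => //.
apply/eqP; rewrite eqn_leq; apply/andP; split.
  by rewrite -Ny N_nd.
by rewrite -Nx N_nd.
Qed.

Lemma integrable_step_path (t : R) :
  mu.-integrable `[0, t] (EFin \o (fun s => h (N s))).
Proof.
apply: measurable_bounded_integrable => //.
- rewrite /= lebesgue_measure_itv/=; case: ifP => _ //=.
  by rewrite -EFinB ltry.
- exact: measurable_step_path.
- exists M; split; first exact: num_real.
  by move=> x Mx s _; exact: le_trans (h_le _) (ltW Mx).
Qed.

Lemma step_path_increment (x y : R) : 0 <= x -> x <= y ->
  I y - I x = \int[mu]_(s in `]x, y]) h (N s).
Proof.
move=> x0 xy; rewrite /I Rintegral_itvB//.
exact: integrable_step_path.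
Qed.

Let itv_fine (x y : R) : x <= y -> fine (mu `]x, y]) = y - x.
Proof.
move=> xy; rewrite /= lebesgue_measure_itv/= lte_fin; case: ltP => //= yx.
by apply/esym/eqP; rewrite subr_eq0 eq_le xy yx.
Qed.

Lemma step_path_increment_const (x y : R) : 0 <= x -> x <= y -> N x = N y ->
  I y - I x = (y - x) * h (N y).
Proof.
move=> x0 xy Nxy; rewrite step_path_increment//.
rewrite (@eq_Rintegral _ _ _ _ _ (cst (h (N y)))).
  by rewrite Rintegral_cst// itv_fine// mulrC.
move=> s; rewrite inE/= in_itv/= => /andP[xs sy]; congr h; apply/eqP.
rewrite eqn_leq N_nd// ?(le_trans x0 (ltW xs))//= -Nxy N_nd//.
exact: ltW.
Qed.

(** The error vanishes on an interval without jump and is at most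
    [2 * M * (y - x)] otherwise; weighting it by the number of jumps makes the
    bound telescope over a subdivision. *)
Lemma step_path_increment_le (x y : R) : 0 <= x -> x <= y ->
  `|I y - I x - (y - x) * h (N y)| <= 2 * M * (y - x) * (N y - N x)%:R.
Proof.
move=> x0 xy; have [Nxy|] := leqP (N y) (N x).
  rewrite step_path_increment_const//; last first.
    by apply/eqP; rewrite eqn_leq Nxy N_nd.
  by rewrite subrr normr0 (eqP (_ : N y - N x == 0)%N) ?mulr0 ?subn_eq0.
move=> NN; have M0 : 0 <= M := le_trans (normr_ge0 _) (h_le 0).
have yx0 : 0 <= y - x by rewrite subr_ge0.
apply: (@le_trans _ _ (2 * M * (y - x))); last first.
  rewrite ler_peMr ?mulr_ge0// ler1n subn_gt0//.
rewrite (le_trans (ler_normB _ _))//.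
have -> : 2 * M * (y - x) = M * (y - x) + (y - x) * M by ring.
apply: lerD; last by rewrite normrM ger0_norm// ler_wpM2l.
rewrite step_path_increment//.
have ii : mu.-integrable `]x, y] (EFin \o (fun s => h (N s))).
  apply: (integrableS _ _ _ (integrable_step_path y)) => //.
  by apply: subset_itvr; rewrite bnd_simp.
apply: (le_trans (le_normr_Rintegral _ ii)) => //.
rewrite -(itv_fine xy) -Rintegral_cst//; apply: le_Rintegral => //.
- exact: integrable_norm.
- apply: measurable_bounded_integrable => //=.
    by rewrite lebesgue_measure_itv/=; case: ifP => _ //=; rewrite -EFinB ltry.
  by exists M; split => [|z Mz s _]; [exact: num_real|rewrite /= ger0_norm// ltW].
Qed.

(** By telescoping, the error of the Riemann sum with step [t / n] is at most
    [2 * M * (t / n) * N t]. *)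
Lemma riemann_sum_cvg (t : R) : 0 <= t ->
  (fun n => \sum_(i < n.+1)
     (t / n.+1%:R) * h (N (t * i.+1%:R / n.+1%:R))) @ \oo --> I t.
Proof.
move=> t0.
have M0 : 0 <= M := le_trans (normr_ge0 _) (h_le 0).
pose x n (i : nat) : R := t * i%:R / n.+1%:R.
have x0 n i : 0 <= x n i by rewrite divr_ge0 ?mulr_ge0.
have xS n i : x n i.+1 - x n i = t / n.+1%:R.
  by rewrite /x -natr1; ring.
have xnd n i : x n i <= x n i.+1 by rewrite -subr_ge0 xS divr_ge0.
have xn n : x n n.+1 = t by rewrite /x mulfK// pnatr_eq0.
have x_0 n : x n 0 = 0 by rewrite /x mulr0 mul0r.
have bound n : `|I t - \sum_(i < n.+1)
     (t / n.+1%:R) * h (N (t * i.+1%:R / n.+1%:R))| <=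
     2 * M * t * (N t)%:R / n.+1%:R.
  have -> : I t = \sum_(i < n.+1) (I (x n i.+1) - I (x n i)).
    rewrite -(big_mkord xpredT (fun i => I (x n i.+1) - I (x n i))).
    rewrite telescope_sumr// xn x_0 [I 0]/I set_itv1 Rintegral_set1 subr0//.
  rewrite -sumrB (le_trans (ler_norm_sum _ _ _))//.
  apply: (@le_trans _ _ (\sum_(i < n.+1)
      (2 * M * (t / n.+1%:R)) * ((N (x n i.+1))%:R - (N (x n i))%:R))).
    apply: ler_sum => i _; rewrite -natrB ?N_nd// -(xS n i).
    exact: step_path_increment_le.
  rewrite -mulr_sumr -(big_mkord xpredT (fun i => (N (x n i.+1))%:R - (N (x n i))%:R)).
  rewrite telescope_sumr// xn x_0.
  have -> : 2 * M * t * (N t)%:R / n.+1%:R = 2 * M * (t / n.+1%:R) * (N t)%:R by ring.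
  rewrite ler_wpM2l ?mulr_ge0 ?divr_ge0// gerBl ler0n //.
apply/cvgrPdist_le => e e0.
have : (fun n => 2 * M * t * (N t)%:R / n.+1%:R) @ \oo --> (0 : R).
  rewrite -[X in _ --> X](mulr0 (2 * M * t * (N t)%:R)).
  by apply: cvgMr; exact: cvg_harmonic.
move=> /cvgrPdist_le/(_ e e0) [k _ H]; exists k => // n kn.
have := H n kn; rewrite sub0r normrN ger0_norm ?divr_ge0 ?mulr_ge0//.
exact: le_trans (bound n).
Qed.

End step_paths.

(** * Laws on generated sigma-algebras and countable partitions *)

(** The two probabilities may live on different spaces: they are compared through
    their images in a common space [Omega], where the uniqueness theorem for
    pi-systems applies. *)
Lemma eq_gen_probability (R : realType) (d d' : measure_display)
    (T : measurableType d) (T' : measurableType d')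
    (P : probability T R) (P' : probability T' R)
    (Omega : pointedType) (f : T -> Omega) (f' : T' -> Omega)
    (G : set (set Omega)) :
  setI_closed G ->
  (forall E, G E -> [/\ measurable (f @^-1` E), measurable (f' @^-1` E) &
     P (f @^-1` E) = P' (f' @^-1` E)]) ->
  forall E, <<s G >> E -> P (f @^-1` E) = P' (f' @^-1` E).
Proof.
move=> GI GP E GE.
suff : [/\ measurable (f @^-1` E), measurable (f' @^-1` E) &
     P (f @^-1` E) = P' (f' @^-1` E)] by case.
move: E GE; apply: (@dynkin_induction _ (g_sigma_algebraType G) G) => //.
- by rewrite !preimage_setT !probability_setT; split.
- move=> S _ [mS mS' SS']; rewrite -!preimage_setC; split; try exact: measurableC.
  by rewrite !probability_setC// SS'.
- move=> F _ tF FP; rewrite !preimage_bigcup; split.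
  + by apply: bigcupT_measurable => k; case: (FP k).
  + by apply: bigcupT_measurable => k; case: (FP k).
  + rewrite !measure_semi_bigcup//; first by apply: eq_eseriesr => k _; case: (FP k).
    * by move=> k; case: (FP k).
    * move=> i j _ _ [w [/= Fi Fj]]; apply: (tF i j) => //.
      by eexists; split; [exact: Fi|exact: Fj].
    * by apply: bigcupT_measurable => k; case: (FP k).
    * by move=> k; case: (FP k).
    * move=> i j _ _ [w [/= Fi Fj]]; apply: (tF i j) => //.
      by eexists; split; [exact: Fi|exact: Fj].
    * by apply: bigcupT_measurable => k; case: (FP k).
Qed.

Lemma probability_partition (R : realType) (d : measure_display)
    (T : measurableType d) (P : probability T R) (A : set T) (f : T -> nat)
    (a : nat -> R) (l : R) :
  (forall k, measurable (A `&` f @^-1` [set k])) ->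
  (forall k, P (A `&` f @^-1` [set k]) = (a k)%:E) ->
  series a @ \oo --> l -> P A = l%:E.
Proof.
move=> mA Pa al.
have AE : A = \bigcup_k (A `&` f @^-1` [set k]).
  by apply/seteqP; split=> [x Ax|x [k _ []]//]; exists (f x).
have tA : trivIset setT (fun k => A `&` f @^-1` [set k]).
  by move=> i j _ _ [x [[_ /= <-] [_ /= <-]]].
have := @measure_semi_sigma_additive _ _ _ P _ mA tA
  (bigcupT_measurable _ mA).
rewrite -AE (_ : (fun n => _) = EFin \o series a); last first.
  apply/funext => n /=; rewrite -sumEFin; apply: eq_bigr => i _; exact: Pa.
move=> /(@cvg_unique _ (@ereal_hausdorff R)); apply.
by apply: cvg_EFin => //; exact: nearW.
Qed.

(** The functions [1], [(-1) ^ n] and [1_{n = 0}] span what is needed to express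
    both the parity of the number of events and the law of the state after [n]
    turns. *)
Lemma poisson_series (R : realType) (L al be ga : R) :
  series (fun n => expR (- L) * L ^+ n / n`!%:R *
    (al + be * (-1) ^+ n + ga * (n == 0%N)%:R)) @ \oo -->
  al + be * expR (- (2 * L)) + ga * expR (- L).
Proof.
have E (x : R) : series (exp_coeff x) @ \oo --> expR x.
  by rewrite /expR; exact: is_cvg_series_exp_coeff.
have Z : series (fun n => (n == 0%N)%:R : R) @ \oo --> (1 : R).
  rewrite -cvg_shiftS (_ : (fun n => _) = (fun=> 1 : R)); first apply: cvg_cst.
  by apply/funext => n; rewrite /series/= big_nat_recl// big1 ?addr0.
have -> : al + be * expR (- (2 * L)) + ga * expR (- L) =
   expR (- L) * al * expR L + expR (- L) * be * expR (- L) + expR (- L) * ga * 1.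
  have e1 : expR (- L) * expR L = 1 by rewrite -expRD addNr expR0.
  have e2 : expR (- (2 * L)) = expR (- L) * expR (- L).
    by rewrite -expRD; congr expR; ring.
  rewrite e2; transitivity (expR (- L) * expR L * al +
    be * (expR (- L) * expR (- L)) + ga * expR (- L)); last by ring.
  by rewrite e1 mul1r.
have -> : series (fun n => expR (- L) * L ^+ n / n`!%:R *
    (al + be * (-1) ^+ n + ga * (n == 0%N)%:R)) =
  (fun n => expR (- L) * al * series (exp_coeff L) n +
     expR (- L) * be * series (exp_coeff (- L)) n +
     expR (- L) * ga * series (fun n => (n == 0%N)%:R) n).
  apply/funext => n; rewrite /series/= !mulr_sumr -!big_split/=.
  apply: eq_bigr => -[|k] _ /=.
    by rewrite /exp_coeff/= fact0 !expr0; field.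
  by rewrite /exp_coeff/= [in (- L) ^+ _]exprNn; ring.
by apply: cvgD; [apply: cvgD|]; apply: cvgMr.
Qed.

(** * Independent sources *)

Section independence.
Context {R : realType} {d : measure_display} {T : measurableType d}
  (P : probability T R).

Lemma prod_fset_iota (m : nat) (F : nat -> \bar R) :
  (\prod_(i <- [fset i in iota 0 m]%fset) F i = \prod_(i < m) F i)%E.
Proof.
rewrite -(big_mkord xpredT F) /index_iota subn0.
apply: perm_big; apply: uniq_perm; rewrite ?fset_uniq ?iota_uniq// => i.
by rewrite inE.
Qed.

(** Keeping the finitely many sources of [E] explicit and outside [K] allows further
    independent constraints, drawn from [K], to be added one at a time. *)
Definition independent_event (I : choiceType) (F : I -> set (set T))
    (K : set I) (E : set T) :=
  exists (J : {fset I}) (A : I -> set T),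
    [/\ forall i, i \in J -> F i (A i), forall i, K i -> i \notin J &
        E = \bigcap_(i in [set` J]) A i].

Lemma independent_event_source (I : choiceType) (F : I -> set (set T))
    (K : set I) (i : I) (E : set T) :
  F i E -> ~ K i -> independent_event F K E.
Proof.
move=> FE Ki; exists [fset i]%fset, (fun=> E); split => //.
- by move=> j; rewrite inE => /eqP ->.
- by move=> j Kj; rewrite inE; apply: contra_notN Ki => /eqP <-.
- by rewrite set_fset1 bigcap_set1.
Qed.

Lemma independent_event_setI (I : choiceType) (F : I -> set (set T))
    (K : set I) (E B : set T) (k : I) :
  mutually_independent P F -> independent_event F K E -> K k -> F k B ->
  P (E `&` B) = (P E * P B)%E /\
  independent_event F (K `\ k) (E `&` B).
Proof.
move=> indF [J [A [FA KJ ->]]] Kk FB.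
pose A' i := if i == k then B else A i.
have kJ : k \notin J by exact: KJ.
have JA' i : i \in J -> A' i = A i.
  by rewrite /A'; case: eqP => // ->; rewrite (negbTE kJ).
have FA' i : i \in (k |` J)%fset -> F i (A' i).
  rewrite in_fset1U => /orP[/eqP ->|iJ]; first by rewrite /A' eqxx.
  by rewrite JA'//; exact: FA.
have EB : (\bigcap_(i in [set` J]) A i) `&` B =
    \bigcap_(i in [set` (k |` J)%fset]) A' i.
  rewrite setIC; apply/seteqP; split => [x [Bx Ax] i /=|x Ax].
    rewrite in_fset1U => /orP[/eqP ->|iJ]; first by rewrite /A' eqxx.
    by rewrite JA'//; exact: Ax.
  split; first by have := Ax k; rewrite /= /A' eqxx; apply; rewrite fset1U1.
  by move=> i /= iJ; rewrite -JA'//; apply: Ax; rewrite /= in_fset1U iJ orbT.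
split.
  rewrite EB indF// big_fsetU1//= indF//; rewrite muleC; congr (_ * _)%E.
    by rewrite big_seq [RHS]big_seq; apply: eq_bigr => i iJ; rewrite JA'.
  by rewrite /A' eqxx.
exists (k |` J)%fset, A'; split => // i [Ki /= ik].
by rewrite in_fset1U negb_or KJ// andbT; apply/eqP.
Qed.

End independence.

(** * Poisson processes *)

Lemma sigma_process_bigcap (R : realType) (d e : measure_display)
    (T : measurableType d) (S : measurableType e) (X : R -> T -> S)
    (m : nat) (F : nat -> set T) :
  (forall i, (i < m)%N -> sigma_process X (F i)) ->
  sigma_process X [set w | forall i, (i < m)%N -> F i w].
Proof.
move=> FX; set G := \bigcup_(t in `[0, +oo[) sigma_rv (X t).
exact: (@bigcap_measurableType _ (g_sigma_algebraType G) F `I_m).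
Qed.

Definition mean_count (R : realType) (mu : R -> R) (s t : R) : R :=
  \int[lebesgue_measure]_(x in `]s, t]) mu x.

Section poisson.
Context {R : realType} {d : measure_display} {T : measurableType d}
  {P : probability T R} {mu : R -> R} {N : R -> T -> nat}.
Hypothesis HN : poisson_process P mu N.

Let N_mono w (s t : R) : 0 <= s -> s <= t -> (N s w <= N t w)%N.
Proof. by case: HN => _ [_ [+ _]]; exact. Qed.

Lemma sigma_process_count (t : R) (B : set nat) :
  0 <= t -> sigma_process N (N t @^-1` B).
Proof.
move=> t0; apply: sub_sigma_algebra; exists t; first by rewrite /= in_itv/= t0.
by exists B => //; rewrite setTI.
Qed.

Lemma measurable_count (t : R) (B : set nat) :
  0 <= t -> measurable (N t @^-1` B).
Proof.
move=> t0; rewrite -[_ @^-1` _]setTI; case: HN => mN _.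
exact: mN.
Qed.

Lemma sigma_process_count2 (s t : R) (B : set (nat * nat)) :
  0 <= s -> 0 <= t -> sigma_process N [set w | B (N s w, N t w)].
Proof.
move=> s0 t0; set G := \bigcup_(t in `[0, +oo[) sigma_rv (N t).
have -> : [set w | B (N s w, N t w)] =
  \bigcup_k (N s @^-1` [set k] `&` N t @^-1` [set l | B (k, l)]).
  apply/seteqP; split => [w Bw|w [k _ [/= <-]]//]; by exists (N s w).
have := @bigcupT_measurable _ (g_sigma_algebraType G); apply => k.
by apply: measurableI; exact: sigma_process_count.
Qed.

Lemma sigma_process_measurable (A : set T) : sigma_process N A -> measurable A.
Proof.
move: A; apply: smallest_sub; first exact: sigma_algebra_measurable.
move=> _ [t /= /[!in_itv]/= /andP[t0 _] [B _ <-]].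
by rewrite setTI; exact: measurable_count.
Qed.

Lemma poisson_increments_independent (t : nat -> R) (B : nat -> set nat) (m : nat) :
  0 <= t 0 -> (forall i, t i <= t i.+1) ->
  P [set w | forall i, (i < m)%N -> B i (N (t i.+1) w - N (t i) w)%N] =
  (\prod_(i < m) P [set w | B i (N (t i.+1) w - N (t i) w)%N])%E.
Proof.
move=> t0 tS; case: HN => _ [_ [_ [_ [+ _]]]].
move=> /(_ t t0 tS [fset i in iota 0 m]%fset
  (fun i => [set w | B i (N (t i.+1) w - N (t i) w)%N])).
rewrite prod_fset_iota => <-.
  congr (P _); apply/seteqP; split => w /= H i.
    by rewrite /= inE mem_iota; exact: H.
  by move=> im; apply: H; rewrite /= inE mem_iota.
by move=> i _; exists (B i) => //; rewrite setTI.
Qed.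

Lemma poisson_increment (s t : R) (k : nat) : 0 <= s -> s <= t ->
  P [set w | (N t w - N s w)%N = k] =
  (expR (- mean_count mu s t) * mean_count mu s t ^+ k / k`!%:R)%:E.
Proof. by move=> s0 st; case: HN => _ [_ [_ [_ [_ [_ law]]]]]; exact: law. Qed.

(** The even and odd parts of the exponential series: the parity indicator of [k]
    is [(1 + (-1) ^ b * (-1) ^ k) / 2]. *)
Lemma poisson_increment_parity (s t : R) (b : bool) : 0 <= s -> s <= t ->
  P [set w | odd (N t w - N s w) = b] =
  ((1 + (-1) ^+ b * expR (- (2 * mean_count mu s t))) / 2)%:E.
Proof.
move=> s0 st; set L := mean_count mu s t.
apply: (@probability_partition _ _ _ _ _ (fun w => (N t w - N s w)%N)
  (fun k => expR (- L) * L ^+ k / k`!%:R *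
    (2^-1 + (-1) ^+ b / 2 * (-1) ^+ k + 0 * (k == 0%N)%:R))).
- move=> k; apply: sigma_process_measurable.
  exact: (@sigma_process_count2 s t
    [set p | odd (p.2 - p.1) = b /\ (p.2 - p.1)%N = k] s0 (le_trans s0 st)).
- move=> k; have [kb|kb] := eqVneq (odd k) b.
    rewrite (_ : _ `&` _ = [set w | (N t w - N s w)%N = k]); last first.
      by apply/seteqP; split => w /=; [case|move=> Nk; rewrite Nk].
    rewrite poisson_increment// -/L; congr EFin.
    have -> : (-1) ^+ k = (-1) ^+ b :> R by rewrite -signr_odd kb.
    by case: (b); rewrite ?expr1 ?expr0; field; rewrite pnatr_eq0 -lt0n fact_gt0.
  rewrite (_ : _ `&` _ = set0) ?measure0; last first.
    by apply/seteqP; split => w //= [Nb Nk]; move/eqP: kb; apply; rewrite -Nk.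
  congr EFin.
  have -> : (-1) ^+ k = - (-1) ^+ b :> R.
    by rewrite -signr_odd -signrN; case: (odd k) (b) kb => -[].
  by case: (b); rewrite ?expr1 ?expr0; field; rewrite pnatr_eq0 -lt0n fact_gt0.
- rewrite [X in _ --> X](_ : _ = 2^-1 + (-1) ^+ b / 2 * expR (- (2 * L)) +
    0 * expR (- L)); last by field.
  exact: poisson_series.
Qed.

End poisson.

(** * Signs of a telegraph process *)

Section telegraph.
Context {R : realType} {d : measure_display} {T : measurableType d}
  {P : probability T R} {v : R} {mu : R -> R} {U : R -> T -> R}
  {D0 : T -> bool} {N : R -> T -> nat}.
Hypothesis v_gt0 : 0 < v.
Hypothesis HN : poisson_process P mu N.
Hypothesis mD0 : measurable_fun setT D0.
Hypothesis PD0 : forall b, P (D0 @^-1` [set b]) = (2^-1)%:E.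
Hypothesis D0N : independent2 P (sigma_rv D0) (sigma_process N).
Hypothesis UE : forall (t : R) w, 0 <= t ->
  U t w = \int[lebesgue_measure]_(s in `[0, t]) (v * (-1) ^+ (D0 w + N s w)).

Definition telegraph_sign (t : R) (w : T) : bool := D0 w (+) odd (N t w).

Let N_mono w (s t : R) : 0 <= s -> s <= t -> (N s w <= N t w)%N.
Proof. by case: HN => _ [_ [+ _]]; exact. Qed.

Let signed_speed w n : R := v * (-1) ^+ (D0 w + n).

Let signed_speed_le w n : `|signed_speed w n| <= v.
Proof. by rewrite normrM normrX normrN1 expr1n mulr1 gtr0_norm. Qed.

Let signed_speed_sign t w : signed_speed w (N t w) = v * (-1) ^+ telegraph_sign t w.
Proof. by rewrite /signed_speed -signr_odd oddD oddb. Qed.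

Lemma telegraph_riemann_sum_cvg (t : R) (w : T) : 0 <= t ->
  (fun n => \sum_(i < n.+1) (t / n.+1%:R) *
     (v * (-1) ^+ telegraph_sign (t * i.+1%:R / n.+1%:R) w)) @ \oo --> U t w.
Proof.
move=> t0; rewrite UE//.
under eq_fun do under eq_bigr do rewrite -signed_speed_sign.
exact: (riemann_sum_cvg (N_mono w) (signed_speed_le w) t0).
Qed.

(** The sign is the right derivative of [U], up to the factor [v]: by right
    continuity of [N] the difference quotients of [U] at [t] are eventually
    equal to it. *)
Lemma telegraph_sign_sigma_process (t : R) (b : bool) : 0 <= t ->
  sigma_process U (telegraph_sign t @^-1` [set b]).
Proof.
move=> t0; set G := \bigcup_(t in `[0, +oo[) sigma_rv (U t).
have mU (s : R) : 0 <= s ->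
    measurable_fun setT (U s : g_sigma_algebraType G -> R).
  move=> s0 _ B mB; rewrite setTI; apply: sub_sigma_algebra; exists s.
    by rewrite /= in_itv/= s0.
  by exists B => //; rewrite setTI.
pose f (w : g_sigma_algebraType G) : R := v * (-1) ^+ telegraph_sign t w.
have mf : measurable_fun setT f.
  pose g (n : nat) (w : g_sigma_algebraType G) : R :=
    (U (t + n.+1%:R^-1) w - U t w) * n.+1%:R.
  apply: (@measurable_fun_cvg _ _ _ _ g).
    move=> n; apply: measurable_funM => //; apply: measurable_funB; apply: mU => //.
    by rewrite addr_ge0// invr_ge0.
  move=> w _; case: HN => _ [_ [_ [rc _]]].
  have [e /= e0 He] := rc w t t0.
  have [k _ Hk] : \forall n \near \oo, n.+1%:R^-1 < e.
    exact: (near_infty_natSinv_lt (PosNum e0)).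
  apply: (@cvg_trans _ ((fun=> f w) @ \oo)); last exact: cvg_cst.
  apply: near_eq_cvg; exists k => // n kn.
  have n0 : 0 < n.+1%:R^-1 :> R by rewrite invr_gt0.
  have Nt : N t w = N (t + n.+1%:R^-1) w.
    apply/esym/He; last by rewrite ltrDl.
    by rewrite /= opprD addNKr normrN gtr0_norm// Hk.
  rewrite /g !UE ?addr_ge0 ?(ltW n0)//.
  have /= -> := step_path_increment_const (N_mono w) (signed_speed_le w) t0 _ Nt.
    rewrite -Nt signed_speed_sign addrAC subrr add0r mulrAC mulVf ?mul1r//.
  by rewrite lerDl ltW.
have fb w : (f w < 0) = telegraph_sign t w.
  rewrite /f pmulr_rlt0//; case: (telegraph_sign t w); rewrite ?expr1 ?expr0.
    by rewrite oppr_lt0 ltr01.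
  by rewrite ltr10.
have -> : telegraph_sign t @^-1` [set b] =
    f @^-1` (if b then `]-oo, 0[%classic else ~` `]-oo, 0[%classic).
  apply/seteqP; split => w /=; rewrite -fb.
    by case: b => [|/negbT] H /=; rewrite in_itv/= ?H//; exact/negP.
  by case: b => /=; rewrite in_itv/=// => /negP/negbTE.
rewrite -[X in sigma_process U X]setTI; apply: mf => //.
by case: b => //; apply: measurableC; exact: measurable_itv.
Qed.

Lemma measurable_telegraph_sign (t : R) (b : bool) : 0 <= t ->
  measurable (telegraph_sign t @^-1` [set b]).
Proof.
move=> t0; have -> : telegraph_sign t @^-1` [set b] =
    \bigcup_n (N t @^-1` [set n] `&` D0 @^-1` [set b (+) odd n]).
  apply/seteqP; split => [w /= <-|w [n _ [/= Nn]]].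
    by exists (N t w) => //; split => //=; rewrite /telegraph_sign addbK.
  by rewrite /telegraph_sign Nn => ->; rewrite addbK.
apply: bigcupT_measurable => n; apply: measurableI.
  exact: (measurable_count HN).
by rewrite -[X in measurable X]setTI; exact: mD0.
Qed.

(** Prescribing the signs at the times [t i] amounts to prescribing the initial
    sign and the parities of the increments of [N], which are independent. *)
Lemma telegraph_sign_fdd (t : nat -> R) (z : nat -> bool) (m : nat) :
  t 0 = 0 -> (forall i, t i <= t i.+1) ->
  P [set w | forall i, (i <= m)%N -> telegraph_sign (t i) w = z i] =
  (2^-1 * \prod_(i < m)
    ((1 + (-1) ^+ (z i (+) z i.+1) *
      expR (- (2 * mean_count mu (t i) (t i.+1)))) / 2))%:E.
Proof.
move=> t0 tS.
have tge0 i : 0 <= t i by elim: i => [|i IH]; rewrite ?t0// (le_trans IH).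
pose B i : set nat := [set k | odd k = z i (+) z i.+1].
have -> : [set w | forall i, (i <= m)%N -> telegraph_sign (t i) w = z i] =
    D0 @^-1` [set z 0] `&`
    [set w | forall i, (i < m)%N -> B i (N (t i.+1) w - N (t i) w)%N].
  have oddN w i : odd (N (t i.+1) w - N (t i) w) =
      telegraph_sign (t i) w (+) telegraph_sign (t i.+1) w.
    rewrite oddB ?N_mono// /telegraph_sign addbACA addbb addFb addbC //.
  have sign0 w : telegraph_sign (t 0) w = D0 w.
    case: HN => _ [N0 _]; by rewrite /telegraph_sign t0 N0 addbF.
  apply/seteqP; split => w /=.
    move=> H; split; first by rewrite -H// sign0.
    by move=> i im; rewrite /B /= oddN !H// ltnW.
  move=> [D0z HB]; elim=> [_|i IH im]; first by rewrite sign0.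
  have := HB i im; rewrite /B /= oddN IH ?(ltnW im)//.
  by move=> /addbI.
rewrite D0N; [|by exists [set z 0] => //; rewrite setTI|]; last first.
  apply: sigma_process_bigcap => i im.
  exact: (@sigma_process_count2 _ _ _ _ (t i) (t i.+1)
    [set p | B i (p.2 - p.1)%N]).
rewrite PD0 (poisson_increments_independent HN) ?t0//.
rewrite EFinM; congr (_ * _)%E; rewrite -prodEFin; apply: eq_bigr => i _.
by rewrite (poisson_increment_parity HN).
Qed.

End telegraph.

(** * The planar motion as a pair of signs *)

(** The booleans tell whether the velocities along [U = (X + Y)/2] and
    [V = (X - Y)/2] are negative. *)
Definition state := (bool * bool)%type.

(** The directions [0, 1, 2, 3] are [(false, false)], [(false, true)],
    [(true, true)], [(true, false)], a Gray code: a turn flips one coordinate,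
    and the sense of the turn decides which one. *)
Definition step (s : state) (u : bool) : state :=
  if (s.1 == s.2) == u then (s.1, ~~ s.2) else (~~ s.1, s.2).

Lemma stepK (s : state) (u : bool) : step (step s u) (~~ u) = s.
Proof. by case: s u => [[] []] []. Qed.

Lemma stepNK (s : state) (u : bool) : step (step s (~~ u)) u = s.
Proof. by case: s u => [[] []] []. Qed.

Definition velocity (R : realType) (s : state) : R * R :=
  (((-1) ^+ s.1 + (-1) ^+ s.2) / 2, ((-1) ^+ s.1 - (-1) ^+ s.2) / 2).

Lemma direction_step (R : realType) (k : int) (s : state) (u : bool) :
  direction R k = velocity R s ->
  direction R (k + (if u then 1 else -1)) = velocity R (step s u).
Proof.
have -> : direction R (k + (if u then 1 else -1)) =
    if u then (- (direction R k).2, (direction R k).1)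
    else ((direction R k).2, - (direction R k).1).
  have pi2 : (1%:~R * pi / 2 : R) = pi / 2 by rewrite mul1r.
  rewrite /direction; case: u.
    by rewrite rmorphD/= !mulrDl pi2 cosDpihalf sinDpihalf.
  rewrite rmorphB/= !mulrBl pi2 cosB sinB cos_pihalf sin_pihalf.
  by rewrite !mulr0 !mulr1 add0r sub0r.
move=> ->; case: s u => [[] []] [];
  rewrite /velocity /step/= ?expr1 ?expr0; congr pair; by field.

Qed.

(** The probability that [n] flips of a uniformly chosen coordinate lead from [s]
    to [s'], diagonalised over the characters of (Z/2)^2: the trivial character
    has eigenvalue [1], the product of the two signs has eigenvalue [-1], and a
    single sign has eigenvalue [0]. *)
Definition transition (R : realType) (n : nat) (s s' : state) : R :=
  (1 + (-1) ^+ ((s.1 (+) s'.1) (+) (s.2 (+) s'.2)) * (-1) ^+ n +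
   ((-1) ^+ (s.1 (+) s'.1) + (-1) ^+ (s.2 (+) s'.2)) * (n == 0%N)%:R) / 4.

Lemma transition0 (R : realType) (s s' : state) :
  transition R 0 s s' = (s == s')%:R.
Proof.
case: s s' => [[] []] [[] []]; rewrite /transition /=
  ?expr1 ?expr0 ?mulr1; by field.
Qed.

Lemma transitionS (R : realType) (n : nat) (s s' : state) :
  transition R n.+1 s s' =
  (transition R n s (step s' true) + transition R n s (step s' false)) / 2.
Proof.
rewrite /transition exprS.
case: s s' => [[] []] [[] []]; rewrite /= ?expr1 ?expr0; by field.
Qed.

(** * Finite-dimensional laws of the planar motion *)

Section chain.
Context {R : realType} {d : measure_display} {T : measurableType d}
  {P : probability T R} {lambda : R -> R}
  {K0 : T -> 'I_4} {turn : nat -> T -> bool} {N : R -> T -> nat}.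
Hypothesis HN : poisson_process P lambda N.
Hypothesis mK0 : forall k, measurable (K0 @^-1` [set k]).
Hypothesis PK0 : forall k, P (K0 @^-1` [set k]) = (4^-1)%:E.
Hypothesis mturn : forall n, measurable_fun setT (turn n).
Hypothesis Pturn : forall n b, P (turn n @^-1` [set b]) = (2^-1)%:E.
Hypothesis indep : mutually_independent P (motion_sources K0 turn N).

Let N_mono w (s t : R) : 0 <= s -> s <= t -> (N s w <= N t w)%N.
Proof. by case: HN => _ [_ [+ _]]; exact. Qed.

Fixpoint chain (n : nat) (w : T) : state :=
  if n is n'.+1 then step (chain n' w) (turn n' w)
  else iter (K0 w) (step^~ true) (false, false).

(** The initial direction [K0] also counts as [K0] positive turns, which the initial
    value of [chain] performs. *)
Lemma direction_chain (t : R) (w : T) :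
  direction R (direction_index K0 turn N t w) = velocity R (chain (N t w) w).
Proof.
rewrite /direction_index; elim: (N t w) => [|n IH].
  rewrite big_ord0 addr0 /=; elim: (nat_of_ord (K0 w)) => [|k IH] /=.
    rewrite /direction /velocity /= mul0r mul0r cos0 sin0 expr0.
    by congr pair; by field.
  by rewrite -addn1 PoszD; apply: (@direction_step _ _ _ true).
by rewrite big_ord_recr/= addrA; exact: direction_step.
Qed.

Lemma measurable_turn n b : measurable (turn n @^-1` [set b]).
Proof. by rewrite -[_ @^-1` _]setTI; exact: mturn. Qed.

Let chain0_eq (s : state) : chain 0 @^-1` [set s] =
  K0 @^-1` [set inord (if s.1 then (if s.2 then 2 else 3)
                       else (if s.2 then 1 else 0))%N].
Proof.
apply/seteqP; split => w /=; last first.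
  by move=> ->; rewrite inordK; case: s => [[] []].
move=> sE; apply/val_inj; rewrite /= inordK -sE; last by case: ifP; case: ifP.
by case: (K0 w) => -[|[|[|[|]]]].
Qed.

Lemma measurable_chain n s : measurable (chain n @^-1` [set s]).
Proof.
elim: n s => [|n IH] s; first by rewrite chain0_eq; exact: mK0.
have -> : chain n.+1 @^-1` [set s] =
   (chain n @^-1` [set step s false] `&` turn n @^-1` [set true]) `|`
   (chain n @^-1` [set step s true] `&` turn n @^-1` [set false]).
  apply/seteqP; split => w /=; last first.
    by case=> [[-> ->]|[-> ->]]; rewrite ?(stepNK s true) ?(stepNK s false).
  by move=> <-; case: (turn n w); [left|right];
    rewrite ?(stepK _ true) ?(stepK _ false).
by apply: measurableU; apply: measurableI => //; exact: measurable_turn.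
Qed.

(** The sources that determine [chain n]. *)
Definition past (n : nat) : set (option (option nat)) :=
  [set i | match i with
           | None => False
           | Some None => True
           | Some (Some k) => (k < n)%N
           end].

Let future (n : nat) (E : set T) :=
  independent_event (motion_sources K0 turn N) (past n) E.

Lemma measurable_future n E : future n E -> measurable E.
Proof.
move=> [J [A [FA _ ->]]]; apply: fin_bigcap_measurable; first exact: finite_fset.
move=> -[[k|]|] /= iJ.
- by have [B _ <-] := FA _ iJ; exact: mturn.
- have [B _ <-] := FA _ iJ; rewrite setTI.
  rewrite (_ : _ @^-1` _ = \bigcup_(k in B) K0 @^-1` [set k]).
    by apply: fin_bigcup_measurable => //; exact: finite_finset.
  by apply/seteqP; split => w /=; [move=> Bw; exists (K0 w)|case=> k Bk ->].
- exact: (sigma_process_measurable HN (FA _ iJ)).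
Qed.

(** Independence of [F] from the turns after the first [n] and from the process of
    events, in the form that an induction over the turns preserves: the value [x]
    of the probability of [F] is carried along. *)
Definition past_event (n : nat) (F : set T) (x : R) :=
  measurable F /\ forall E, future n E -> P (E `&` F) = (P E * x%:E)%E.

Lemma past_event_chain0 s : past_event 0 (chain 0 @^-1` [set s]) (4^-1).
Proof.
split=> [|E fE]; first exact: measurable_chain.
rewrite chain0_eq; set k := inord _.
have [||-> _] := independent_event_setI indep fE (k := Some None)
  (B := K0 @^-1` [set k]).
- by [].
- by exists [set k] => //; rewrite setTI.
- by rewrite PK0.
Qed.

(** By induction on [r]: the last step is undone by conditioning on the last turn,
    which is a fair coin independent of [F] and of the preceding turns. *)
Lemma past_event_chain n F x s s' r : F `<=` chain n @^-1` [set s] ->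
  past_event n F x ->
  past_event (n + r) (F `&` chain (n + r) @^-1` [set s'])
    (x * transition R r s s').
Proof.
move=> Fs [mF FE]; elim: r s' => [|r IH] s'.
  rewrite addn0 transition0; have [<-|ss'] := eqVneq s s'.
    rewrite mulr1 (_ : _ `&` _ = F); first by split.
    by apply/seteqP; split => [w []//|w Fw]; split => //; exact: Fs.
  rewrite mulr0 (_ : _ `&` _ = set0).
    by split=> // E _; rewrite setI0 measure0 mule0.
  apply/seteqP; split => // w [/Fs /= ->] /eqP.
  by rewrite (negbTE ss').
rewrite addnS; split => [|E fE].
  by apply: measurableI => //; exact: measurable_chain.
pose C u := F `&` chain (n + r) @^-1` [set step s' (~~ u)].
have split_turn : E `&` (F `&` chain (n + r).+1 @^-1` [set s']) =
    (E `&` turn (n + r) @^-1` [set true] `&` C true) `|`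
    (E `&` turn (n + r) @^-1` [set false] `&` C false).
  apply/seteqP; split => w /=; last first.
    by case=> [[[Ew ->] [Fw ->]]|[[Ew ->] [Fw ->]]];
      rewrite ?(stepNK s' true) ?(stepNK s' false).
  move=> [Ew [Fw sE]]; case tw: (turn (n + r) w); [left|right];
    by split => //; split => //=; rewrite -sE tw ?(stepK _ true) ?(stepK _ false).
have piece u : P (E `&` turn (n + r) @^-1` [set u] `&` C u) =
    (P E * (2^-1 * (x * transition R r s (step s' (~~ u))))%:E)%E.
  have [_ CE] := IH (step s' (~~ u)).
  have [||PEu fEu] := independent_event_setI indep fE (k := Some (Some (n + r)))
      (B := turn (n + r) @^-1` [set u]).
  - exact: ltnSn.
  - by exists [set u] => //; rewrite setTI.
  rewrite CE.
    by rewrite PEu Pturn -muleA.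
  rewrite /future (_ : past (n + r) = past (n + r).+1 `\ Some (Some (n + r))).
    exact: fEu.
  apply/seteqP; split => -[[k|]|] //=.
  - by move=> kr; split; [exact: ltnW|move=> [kE]; move: kr; rewrite kE ltnn].
  - by move=> [kr ne]; rewrite ltn_neqAle -ltnS kr andbT;
      apply/eqP => kE; apply: ne; rewrite kE.
  - by case.
have mpiece u : measurable (E `&` turn (n + r) @^-1` [set u] `&` C u).
  apply: measurableI; first apply: measurableI.
  - exact: measurable_future fE.
  - exact: measurable_turn.
  - by apply: measurableI => //; exact: measurable_chain.
rewrite split_turn measureU//; last first.
  by apply/seteqP; split => // w [[[_ /= ->] _] [[_]]].
transitivity (P (E `&` turn (n + r) @^-1` [set true] `&` C true) +
  P (E `&` turn (n + r) @^-1` [set false] `&` C false))%E; first by [].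
rewrite !piece -(fineK (fin_num_measure P E (measurable_future fE))).
by rewrite -!EFinM -EFinD transitionS; congr EFin; field.
Qed.

(* The number of events before the i-th observation when n j events occur between
   the observations j and j.+1. *)
Let count (n : nat -> nat) (i : nat) : nat := (\sum_(j < i) n j)%N.

Lemma past_event_skeleton (n : nat -> nat) (z : nat -> state) (m : nat) :
  past_event (count n m)
    [set w | forall i, (i < m.+1)%N -> chain (count n i) w = z i]
    (4^-1 * \prod_(i < m) transition R (n i) (z i) (z i.+1)).
Proof.
elim: m => [|m IH].
  rewrite big_ord0 mulr1 /count big_ord0.
  rewrite (_ : [set w | _] = chain 0 @^-1` [set z 0]).
    exact: past_event_chain0.
  apply/seteqP; split => w /=; first by move=> /(_ 0 isT); rewrite big_ord0.
  by move=> cw [|//] _; rewrite big_ord0.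
rewrite big_ord_recr/= mulrA.
have -> : [set w | forall i, (i < m.+2)%N -> chain (count n i) w = z i] =
    [set w | forall i, (i < m.+1)%N -> chain (count n i) w = z i] `&`
    chain (count n m + n m) @^-1` [set z m.+1].
  have cS : (count n m + n m)%N = count n m.+1 by rewrite /count big_ord_recr.
  rewrite cS; apply/seteqP; split => w /=.
    by move=> H; split; [move=> i im; apply/H/leqW|exact: H].
  by move=> [H Hm] i; rewrite ltnS leq_eqVlt => /orP[/eqP ->//|]; exact: H.
have -> : count n m.+1 = (count n m + n m)%N by rewrite /count big_ord_recr.
apply: past_event_chain IH => w /= H.
exact: H.
Qed.

Definition motion_state (t : R) (w : T) : state := chain (N t w) w.

Lemma measurable_motion_state (t : R) (s : state) : 0 <= t ->
  measurable (motion_state t @^-1` [set s]).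
Proof.
move=> t0; have -> : motion_state t @^-1` [set s] =
    \bigcup_n (N t @^-1` [set n] `&` chain n @^-1` [set s]).
  apply/seteqP; split => [w /= <-|w [n _ [/= Nn]]]; first by exists (N t w).
  by rewrite /motion_state Nn.
apply: bigcupT_measurable => n; apply: measurableI; last exact: measurable_chain.
exact: (measurable_count HN).
Qed.

(** Two independent signs, each flipped an odd number of times with probability
    [(1 - exp (- L)) / 2]. *)
Definition split_transition (L : R) (s s' : state) : R :=
  ((1 + (-1) ^+ (s.1 (+) s'.1) * expR (- L)) / 2) *
  ((1 + (-1) ^+ (s.2 (+) s'.2) * expR (- L)) / 2).

(** Thinning: after a Poisson number of flips of mean [L] the two coordinates are
    independent.  The constant [C] carries the factors of the other time
    intervals. *)
Lemma poisson_transition (C L : R) (s s' : state) :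
  series (fun n => C * (expR (- L) * L ^+ n / n`!%:R * transition R n s s'))
    @ \oo --> C * split_transition L s s'.
Proof.
pose al := (s.1 (+) s'.1); pose be := (s.2 (+) s'.2).
have -> : (fun n => C * (expR (- L) * L ^+ n / n`!%:R * transition R n s s')) =
  (fun n => expR (- L) * L ^+ n / n`!%:R * (C / 4 +
     C * (-1) ^+ (al (+) be) / 4 * (-1) ^+ n +
     C * ((-1) ^+ al + (-1) ^+ be) / 4 * (n == 0%N)%:R)).
  by apply/funext => n; rewrite /transition -/al -/be; ring.
have -> : C * split_transition L s s' = C / 4 +
    C * (-1) ^+ (al (+) be) / 4 * expR (- (2 * L)) +
    C * ((-1) ^+ al + (-1) ^+ be) / 4 * expR (- L).
  have -> : expR (- (2 * L)) = expR (- L) * expR (- L).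
    by rewrite -expRD; congr expR; ring.
  by rewrite signr_addb /split_transition -/al -/be; field.
exact: poisson_series.
Qed.

(** When all the increments of [N] between the observation times are prescribed, the
    event factors into an event of [N] and a [past_event] of the chain.  The
    increments are then released one at a time, each release being a sum over the
    number of events in one interval. *)
Lemma motion_state_fdd (t : nat -> R) (z : nat -> state) (m : nat) :
  t 0 = 0 -> (forall i, t i <= t i.+1) ->
  P [set w | forall i, (i <= m)%N -> motion_state (t i) w = z i] =
  (4^-1 * \prod_(i < m)
     split_transition (mean_count lambda (t i) (t i.+1)) (z i) (z i.+1))%:E.
Proof.
move=> t0 tS.
have tge0 i : 0 <= t i by elim: i => [|i IH]; rewrite ?t0// (le_trans IH).
pose L i := mean_count lambda (t i) (t i.+1).
pose dN i w := (N (t i.+1) w - N (t i) w)%N.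
(* The increments of the first l intervals are released. *)
pose G l (n : nat -> nat) :=
  [set w | forall i, (i < m.+1)%N -> motion_state (t i) w = z i] `&`
  [set w | forall i, (i < m)%N -> (l <= i)%N -> dN i w = n i].
pose term l (n : nat -> nat) (i : nat) : R :=
  if (i < l)%N then split_transition (L i) (z i) (z i.+1)
  else expR (- L i) * L i ^+ n i / (n i)`!%:R *
       transition R (n i) (z i) (z i.+1).
suff GE l n : (l <= m)%N -> P (G l n) = (4^-1 * \prod_(i < m) term l n i)%:E.
  have := GE m (fun=> 0%N) (leqnn m).
  rewrite (_ : G m (fun=> 0%N) =
      [set w | forall i, (i <= m)%N -> motion_state (t i) w = z i]).
    by move=> ->; congr (4^-1 * _)%:E; apply: eq_bigr => i _; rewrite /term ltn_ord.
  apply/seteqP; split => w /=; first by case.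
  by move=> H; split => // i im mi; rewrite ltnNge mi in im.
elim: l n => [|l IH] n lm.
  have N_count w : (forall i, (i < m)%N -> dN i w = n i) ->
      forall i, (i <= m)%N -> N (t i) w = count n i.
    move=> H; elim=> [_|i IHi im].
      by rewrite /count big_ord0 t0; case: HN => _ [-> _].
    rewrite /count big_ord_recr/= -/(count n i) -IHi ?(ltnW im)// -H//.
    by rewrite /dN subnKC// N_mono.
  have -> : G 0%N n = [set w | forall i, (i < m)%N -> [set n i] (dN i w)] `&`
      [set w | forall i, (i < m.+1)%N -> chain (count n i) w = z i].
    apply/seteqP; split => w /= [A B].
      split => [i im|i im]; first exact: B.
      by rewrite -(N_count w)//; [exact: A|move=> j jm; exact: B].
    split => [i im|i im _]; last exact: A.
    by rewrite /motion_state (N_count w)//; exact: B.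
  have [_ ->] := past_event_skeleton n z m; last first.
    apply: (independent_event_source (i := None)) => //.
    apply: (sigma_process_bigcap (F := fun i => [set w | dN i w = n i])) => i im.
    exact: (@sigma_process_count2 _ _ _ _ (t i) (t i.+1)
      [set p | (p.2 - p.1)%N = n i]).
  rewrite (poisson_increments_independent HN (fun i => [set n i])) ?t0//.
  under eq_bigr do rewrite /= (poisson_increment HN)//.
  rewrite prodEFin -EFinM; congr EFin.
  by rewrite mulrCA -big_split.
apply: (@probability_partition _ _ _ _ _ (dN l)
  (fun k => 4^-1 * \prod_(i < m) term l (fun i => if i == l then k else n i) i)).
- move=> k; apply: measurableI; first apply: measurableI.
  + apply: (@bigcap_measurableType _ _
      (fun i => motion_state (t i) @^-1` [set z i]) `I_m.+1).
    by move=> i _; exact: measurable_motion_state.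
  + apply: (@bigcap_measurableType _ _
      (fun i => [set w | (l < i)%N -> dN i w = n i]) `I_m) => i _.
    apply: (sigma_process_measurable HN).
    exact: (@sigma_process_count2 _ _ _ _ (t i) (t i.+1)
      [set p | (l < i)%N -> (p.2 - p.1)%N = n i]).
  + apply: (sigma_process_measurable HN).
    exact: (@sigma_process_count2 _ _ _ _ (t l) (t l.+1)
      [set p | (p.2 - p.1)%N = k]).
- move=> k; rewrite -IH ?(ltnW lm)//; congr (P _); apply/seteqP; split => w /=.
    move=> [[A B] lk]; split => // i im li; case: eqP => [->//|/eqP il].
    by apply: B => //; rewrite ltn_neqAle eq_sym il.
  move=> [A B]; split; last by rewrite B// eqxx.
  by split => // i im li; rewrite B ?(ltnW li)//; case: eqP li => // ->; rewrite ltnn.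
- pose C := 4^-1 * \prod_(i < m | i != Ordinal lm) term l.+1 n i.
  have Cl l' n' : (forall i : 'I_m, i != Ordinal lm -> term l' n' i = term l.+1 n i) ->
      4^-1 * \prod_(i < m) term l' n' i = C * term l' n' l.
    move=> H; rewrite (bigD1 (Ordinal lm))//= mulrCA mulrC; congr (_ * _ * _).
    exact: eq_bigr.
  rewrite (_ : (fun k => _) = (fun k => C * (expR (- L l) * L l ^+ k / k`!%:R *
       transition R k (z l) (z l.+1)))).
    rewrite (Cl l.+1 n)// /term ltnSn; exact: poisson_transition.
  apply/funext => k; rewrite Cl.
    by rewrite /term ltnn eqxx.
  move=> i il; have {}il : (i : nat) != l by apply: contra_neq il => il; apply/val_inj.
  by rewrite /term (negbTE il) ltnS [in RHS]leq_eqVlt (negbTE il).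
Qed.

Lemma motion_riemann_sum_cvg (c : R) (p : R * R -> R) (t : R) (w : T) :
  0 < c -> (forall s, `|p (velocity R s)| <= 1) -> 0 <= t ->
  (fun n => \sum_(i < n.+1) (t / n.+1%:R) *
     (c * p (velocity R (motion_state (t * i.+1%:R / n.+1%:R) w)))) @ \oo -->
  (\int[lebesgue_measure]_(s in `[0, t])
     (c * p (direction R (direction_index K0 turn N s w))) : R).
Proof.
move=> c0 p1 t0; under eq_Rintegral do rewrite direction_chain.
apply: (@riemann_sum_cvg R (N ^~ w) (fun n => c * p (velocity R (chain n w))) c
  (N_mono w) _ t t0) => n.
by rewrite normrM gtr0_norm// ger_pMr.
Qed.

End chain.

(** * From states to positions *)

Lemma mean_count_half (R : realType) (d : measure_display) (T : measurableType d)
    (P : probability T R) (lambda : R -> R) (N : R -> T -> nat) (s t : R) :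
  poisson_process P lambda N -> 0 <= s -> s <= t ->
  2 * mean_count (fun x => lambda x / 2) s t = mean_count lambda s t.
Proof.
move=> [_ [_ [_ [_ [_ [ilambda _]]]]]] s0 st; rewrite /mean_count RintegralZr//.
  by rewrite mulrCA divff// mulr1.
apply: (integrableS _ _ _ (ilambda t (le_trans s0 st))) => //.
by apply: subset_itvr; rewrite bnd_simp.
Qed.

(** Arbitrary observation times are listed in increasing order; the sequence is
    constant after its [m]-th term. *)
Lemma sort_times (R : realType) (ts : seq R) :
  (forall x, x \in ts -> 0 <= x) -> 0 \in ts ->
  exists (t : nat -> R) (m : nat),
    [/\ t 0 = 0, forall i, t i <= t i.+1,
        forall i, t i \in ts & forall x, x \in ts -> exists2 i, (i <= m)%N & t i = x].
Proof.
move=> ts0 t0; pose ss := 0 :: sort <=%R ts.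
have sss : sorted <=%R ss.
  rewrite /= path_sortedE; last exact: le_trans.
  rewrite sort_le_sorted andbT; apply/allP => x; rewrite mem_sort; exact: ts0.
have ssts x : (x \in ss) = (x \in ts).
  by rewrite inE mem_sort; case: eqP => // ->; rewrite t0.
have sz i : (minn i (size ts) < size ss)%N.
  by rewrite /= size_sort ltnS geq_minr.
exists (fun i => nth 0 ss (minn i (size ts))), (size ts); split.
- by rewrite min0n.
- move=> i; apply: (sorted_leq_nth le_trans le_refl 0 sss); rewrite ?inE ?sz//.
  by rewrite leq_min geq_minr andbT (leq_trans (geq_minl _ _)).
- by move=> i; rewrite -ssts mem_nth.
- move=> x; rewrite -ssts => xs; exists (index x ss); last first.
    by rewrite (minn_idPl _) ?nth_index// -ltnS -(size_sort <=%R ts) index_mem.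
  by rewrite -ltnS -(size_sort <=%R ts) index_mem.
Qed.

Section cylinders.
Context {R : realType} {Omega : pointedType} (Z : R -> Omega -> state).

(** Cylinders always observe the time [0], where the laws of the states are anchored;
    this loses nothing, as [measurable_cylinder_state] shows. *)
Definition cylinder : set (set Omega) := [set E |
  [\/ E = set0, E = setT | exists (ts : seq R) (z : R -> state),
    [/\ forall x, x \in ts -> 0 <= x, 0 \in ts &
        E = [set w | forall x, x \in ts -> Z x w = z x]]]].

Lemma cylinder_setI : setI_closed cylinder.
Proof.
move=> E F [->|->|[ts [z [ts0 t0 ->]]]].
- by move=> _; rewrite set0I; constructor 1.
- by rewrite setTI.
move=> [->|->|[us [y [us0 _ ->]]]].
- by rewrite setI0; constructor 1.
- by rewrite setIT; constructor 3; exists ts, z.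
have [zy|/allPn[x /[!mem_filter] /andP[xu xt] zyx]] :=
    boolP (all (fun x => z x == y x) [seq x <- ts | x \in us]); last first.
  constructor 1; apply/seteqP; split => // w /= [Zz Zy].
  by move/eqP: zyx; apply; rewrite -Zz// Zy.
constructor 3; exists (ts ++ us), (fun x => if x \in ts then z x else y x); split.
- by move=> x; rewrite mem_cat => /orP[]; [exact: ts0|exact: us0].
- by rewrite mem_cat t0.
apply/seteqP; split => w /=.
  move=> [Zz Zy] x; rewrite mem_cat; case: ifPn => [xt _|_ /=]; first exact: Zz.
  exact: Zy.
move=> H; split => x xs; first by rewrite H ?mem_cat xs.
rewrite H ?mem_cat ?xs ?orbT//; case: ifPn => // xt.
by apply/eqP; apply: (allP zy); rewrite mem_filter xs.
Qed.

Lemma measurable_cylinder_state (f : state -> R) (t : R) : 0 <= t ->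
  measurable_fun setT (fun w : g_sigma_algebraType cylinder => f (Z t w)).
Proof.
move=> t0 _ B mB; rewrite setTI.
have -> : (fun w : g_sigma_algebraType cylinder => f (Z t w)) @^-1` B =
    \bigcup_(s in [set s | B (f s)]) \bigcup_(s0 in [set: state])
      [set w | forall x, x \in [:: 0; t] -> Z x w = if x == t then s else s0].
  apply/seteqP; split => [w /= Bw|w [s /= Bs [s0 _ /= H]]].
    exists (Z t w) => //; exists (Z 0 w) => // x; rewrite !inE.
    by have [->//|_] := eqVneq x t; rewrite orbF => /eqP ->.
  by rewrite (H t) ?eqxx// !inE eqxx orbT.
apply: fin_bigcup_measurable => [|s _]; first exact: finite_finset.
apply: fin_bigcup_measurable => [|s0 _]; first exact: finite_finset.
apply: sub_sigma_algebra; constructor 3.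
exists [:: 0; t], (fun x => if x == t then s else s0); split => //.
  by move=> x; rewrite !inE => /orP[] /eqP ->.
by rewrite !inE eqxx.
Qed.

End cylinders.

(** The disjoint union is the space in which both motions are observed; generating a
    sigma-algebra on it requires a base point. *)
HB.instance Definition _ (T T' : pointedType) :=
  isPointed.Build (T + T')%type (inl point).

(** Both motions are glued into a single one on [T + T'], so that each position is a
    limit of the same Riemann sums of states on all of [T + T'].  It is therefore
    measurable for the sigma-algebra generated by the cylinders of the glued
    states, on which the two laws agree. *)
Lemma eq_in_distribution_of_states (R : realType) (d d' : measure_display)
    (T : measurableType d) (T' : measurableType d')
    (P : probability T R) (P' : probability T' R)
    (Z : R -> T -> state) (Z' : R -> T' -> state)
    (X : R -> T -> R * R) (X' : R -> T' -> R * R)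
    (f g : state -> R) :
  (forall t s, 0 <= t -> measurable (Z t @^-1` [set s])) ->
  (forall t s, 0 <= t -> measurable (Z' t @^-1` [set s])) ->
  (forall (t : nat -> R) (z : nat -> state) (m : nat),
    t 0 = 0 -> (forall i, t i <= t i.+1) ->
    P [set w | forall i, (i <= m)%N -> Z (t i) w = z i] =
    P' [set w | forall i, (i <= m)%N -> Z' (t i) w = z i]) ->
  (forall (t : R) w, 0 <= t ->
     (fun n => \sum_(i < n.+1) (t / n.+1%:R) *
       f (Z (t * i.+1%:R / n.+1%:R) w)) @ \oo --> (X t w).1 /\
     (fun n => \sum_(i < n.+1) (t / n.+1%:R) *
       g (Z (t * i.+1%:R / n.+1%:R) w)) @ \oo --> (X t w).2) ->
  (forall (t : R) w, 0 <= t ->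
     (fun n => \sum_(i < n.+1) (t / n.+1%:R) *
       f (Z' (t * i.+1%:R / n.+1%:R) w)) @ \oo --> (X' t w).1 /\
     (fun n => \sum_(i < n.+1) (t / n.+1%:R) *
       g (Z' (t * i.+1%:R / n.+1%:R) w)) @ \oo --> (X' t w).2) ->
  eq_in_distribution P X P' X'.
Proof.
move=> mZ mZ' fdd XE XE' A sA.
pose glue (V : Type) (F : R -> T -> V) (F' : R -> T' -> V) (t : R)
    (w : (T + T')%type) : V :=
  match w with inl w => F t w | inr w => F' t w end.
pose ZZ := glue _ Z Z'; pose XX := glue _ X X'.
pose sigma := <<s cylinder ZZ >>.
suff sXX : sigma [set w | A (XX ^~ w)].
  apply: (@eq_gen_probability _ _ _ _ _ P P' _ inl inr (cylinder ZZ)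
    (@cylinder_setI _ _ ZZ) _ _ sXX).
  move=> E [->|->|[ts [z [ts0 t0 ->]]]].
  - by rewrite !preimage_set0 !measure0; split.
  - by rewrite !preimage_setT !probability_setT; split.
  have [t [m [t00 tS tts ts_t]]] := sort_times ts0 t0.
  have tge0 i : 0 <= t i by exact: ts0.
  have -> : inl @^-1` [set w | forall x, x \in ts -> ZZ x w = z x] =
      [set w | forall i, (i <= m)%N -> Z (t i) w = z (t i)].
    apply/seteqP; split => w /= H => [i _|x /ts_t[i im <-]]; last exact: H.
    exact: (H (t i)).
  have -> : inr @^-1` [set w | forall x, x \in ts -> ZZ x w = z x] =
      [set w | forall i, (i <= m)%N -> Z' (t i) w = z (t i)].
    apply/seteqP; split => w /= H => [i _|x /ts_t[i im <-]]; last exact: H.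
    exact: (H (t i)).
  split; last exact: fdd.
  + apply: (@bigcap_measurableType _ _
      (fun i => Z (t i) @^-1` [set z (t i)]) `I_m.+1).
    by move=> i _; exact: mZ.
  + apply: (@bigcap_measurableType _ _
      (fun i => Z' (t i) @^-1` [set z (t i)]) `I_m.+1).
    by move=> i _; exact: mZ'.
have mXX (t : R) : 0 <= t ->
    measurable_fun setT (XX t : g_sigma_algebraType (cylinder ZZ) -> R * R).
  move=> t0.
  have mlim (h : state -> R) (Y : g_sigma_algebraType (cylinder ZZ) -> R) :
      (forall w, (fun n => \sum_(i < n.+1) (t / n.+1%:R) *
         h (ZZ (t * i.+1%:R / n.+1%:R) w)) @ \oo --> Y w) ->
      measurable_fun setT Y.
    move=> hY; pose S n (w : g_sigma_algebraType (cylinder ZZ)) : R :=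
      \sum_(i < n.+1) (t / n.+1%:R) * h (ZZ (t * i.+1%:R / n.+1%:R) w).
    apply: (@measurable_fun_cvg _ _ _ _ S) => [n|w _]; last exact: hY.
    apply: measurable_sum => i; apply: measurable_funM => //.
    apply: measurable_cylinder_state; rewrite divr_ge0 ?mulr_ge0//.
  apply/measurable_fun_pairP; split.
    by apply: (mlim f) => -[w|w]; [case: (XE t w t0)|case: (XE' t w t0)].
  by apply: (mlim g) => -[w|w]; [case: (XE t w t0)|case: (XE' t w t0)].
pose path (w : (T + T')%type) : R -> R * R := XX ^~ w.
suff : sigma_process (fun t (x : R -> R * R) => x t) `<=`
    image_set_system setT path sigma.
  by move=> /(_ A sA); rewrite /image_set_system /= setTI.
apply: smallest_sub.
  apply: sigma_algebra_image.
  exact: (@sigma_algebra_measurable _ (g_sigma_algebraType (cylinder ZZ))).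
move=> _ [t /= /[!in_itv]/= /andP[t0 _] [B mB <-]].
rewrite /image_set_system /= !setTI.
by have := mXX t t0 measurableT B mB; rewrite setTI.
Qed.

(** * The theorem *)

Unset Implicit Arguments.

Theorem theorem2p2 (R : realType) (c : R) (lambda : R -> R)
    (d d' : measure_display)
    (T : measurableType d) (P : probability T R) (X Y : R -> T -> R)
    (T' : measurableType d') (P' : probability T' R) (U V : R -> T' -> R) :
  0 < c -> C2_nonneg lambda ->
  orthogonal_motion P c lambda X Y ->
  telegraph_process P' (c / 2) (fun t => lambda t / 2) U ->
  telegraph_process P' (c / 2) (fun t => lambda t / 2) V ->
  independent2 P' (sigma_process U) (sigma_process V) ->
  eq_in_distribution P (fun t w => (X t w, Y t w))
    P' (fun t w => (U t w + V t w, U t w - V t w)).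
Proof.
move=> c0 _ [K0 [turn [N [HN [mK0 [PK0 [mturn [Pturn [indep XYE]]]]]]]]].
move=> [DU [NU [HNU [mDU [PDU [DNU UE]]]]]] [DV [NV [HNV [mDV [PDV [DNV VE]]]]]] UV.
have c2 : 0 < c / 2 by rewrite divr_gt0.
pose aU := telegraph_sign (D0 := DU) (N := NU).
pose aV := telegraph_sign (D0 := DV) (N := NV).
apply: (@eq_in_distribution_of_states _ _ _ _ _ _ _
  (motion_state (K0 := K0) (turn := turn) (N := N)) (fun t w => (aU t w, aV t w)) _ _
  (fun s => c * (velocity R s).1) (fun s => c * (velocity R s).2)).
- by move=> t s t0; exact: (measurable_motion_state HN).
- move=> t [a b] t0; rewrite (_ : _ @^-1` _ =
    aU t @^-1` [set a] `&` aV t @^-1` [set b]).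
    by apply: measurableI; [exact: (measurable_telegraph_sign HNU)|
      exact: (measurable_telegraph_sign HNV)].
  by apply/seteqP; split => w /= [-> ->].
- move=> t z m t0 tS.
  have tge0 i : 0 <= t i by elim: i => [|i IH]; rewrite ?t0// (le_trans IH).
  rewrite (motion_state_fdd HN)//.
  rewrite (_ : [set w | _] =
    [set w | forall i, (i < m.+1)%N -> aU (t i) w = (z i).1] `&`
    [set w | forall i, (i < m.+1)%N -> aV (t i) w = (z i).2]); last first.
    apply/seteqP; split => w /=; first by move=> H; split => i im; rewrite -H.
    by move=> [HU HV] i im; rewrite HU// HV//; case: (z i).
  rewrite UV; [|apply: (sigma_process_bigcap
      (F := fun i => aU (t i) @^-1` [set (z i).1])) => i _;
      exact: (telegraph_sign_sigma_process c2 HNU)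
    |apply: (sigma_process_bigcap
      (F := fun i => aV (t i) @^-1` [set (z i).2])) => i _;
      exact: (telegraph_sign_sigma_process c2 HNV)].
  rewrite (telegraph_sign_fdd HNU PDU DNU (fun i => (z i).1))//.
  rewrite (telegraph_sign_fdd HNV PDV DNV (fun i => (z i).2))//.
  rewrite -EFinM; congr EFin; rewrite mulrACA -big_split/=; congr (_ * _).
    by field.
  by apply: eq_bigr => i _; rewrite /split_transition (mean_count_half HN).
- move=> t w t0; have [-> ->] := XYE t w t0.
  have v1 s : `|(velocity R s).1| <= 1 /\ `|(velocity R s).2| <= 1.
    by case: s => [[] []]; rewrite /velocity /= ?expr1 ?expr0;
      split; rewrite ler_norml; lra.
  split.
    exact: (motion_riemann_sum_cvg HN (p := fst) c0 (fun s => (v1 s).1)).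
  exact: (motion_riemann_sum_cvg HN (p := snd) c0 (fun s => (v1 s).2)).
- move=> t w t0.
  have cU := telegraph_riemann_sum_cvg c2 HNU UE (w := w) t0.
  have cV := telegraph_riemann_sum_cvg c2 HNV VE (w := w) t0.
  split.
    apply: cvg_trans (cvgD cU cV); apply: near_eq_cvg; apply: nearW => n /=.
    by rewrite !fctE -big_split; apply: eq_bigr => i _ /=; field.
  apply: cvg_trans (cvgB cU cV); apply: near_eq_cvg; apply: nearW => n /=.
  by rewrite !fctE -sumrB; apply: eq_bigr => i _ /=; field.
Qed.
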